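(* For every $\varepsilon > 0$, all reals $\lambda > \lambda' > 0$, and every functional $M_1 : \mathbb{N}^{\mathbb{N}} \to \mathbb{N}$, there is a functional $M_2 : \mathbb{N}^{\mathbb{N}} \to \mathbb{N}$ with the following property: for any probability space $(X, \mathcal{B}, \mu)$ and any sequence $(f_n)_{n \in \mathbb{N}}$ of measurable real-valued functions on $X$, if $M_1$ is a $\lambda'$-uniform bound on the $\varepsilon$-metastable pointwise convergence of $(f_n)$, then $M_2$ is a bound on the $\lambda$-uniform $\varepsilon$-metastable convergence of $(f_n)$. In other words, if for every $F_1 : \mathbb{N} \to \mathbb{N}$ \[ \mu(\{x \in X : \exists m \leq M_1(F_1)\ \forall n, n' \in [m,F_1(m)]\ |f_n(x) - f_{n'}(x)| < \varepsilon\}) > 1 - \lambda', \] then for every $F_2 : \mathbb{N} \to \mathbb{N}$ there is an $m \leq M_2(F_2)$ such that \[ \mu(\{x \in X : \forall n, n' \in [m,F_2(m)]\ |f_n(x) - f_{n'}(x)| < \varepsilon\}) > 1 - \lambda. \]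
   Context: A functional is an arbitrary map $M$ assigning a natural number $M(F)$ to each function $F : \mathbb{N} \to \mathbb{N}$. For natural numbers $m, k$, $[m,k]$ denotes $\{n \in \mathbb{N} : m \leq n \leq k\}$ (empty if $k < m$). A functional $M$ is a $\lambda$-uniform bound on the $\varepsilon$-metastable pointwise convergence of $(f_n)$ if for every $F : \mathbb{N} \to \mathbb{N}$, \[ \mu(\{x : \forall m \leq M(F)\ \exists n, n' \in [m,F(m)]\ |f_n(x) - f_{n'}(x)| \geq \varepsilon\}) < \lambda. \] A functional $M$ is a bound on the $\lambda$-uniform $\varepsilon$-metastable convergence of $(f_n)$ if for every $F : \mathbb{N} \to \mathbb{N}$ there is an $m \leq M(F)$ such that \[ \mu(\{x : \exists n, n' \in [m,F(m)]\ |f_n(x) - f_{n'}(x)| \geq \varepsilon\}) < \lambda. \] The functional $M_2$ depends only on $\varepsilon, \lambda, \lambda', M_1$, and not on the probability space or the sequence. *)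

(* Defs.v *)
From HB Require Import structures.
From mathcomp Require Import all_boot all_order all_algebra.
From mathcomp Require Import all_classical all_reals all_analysis.

Set Implicit Arguments.
Unset Strict Implicit.
Unset Printing Implicit Defensive.

Import Order.TTheory GRing.Theory Num.Theory.
Import numFieldNormedType.Exports.

Local Open Scope classical_set_scope.
Local Open Scope ring_scope.

(* No continuity or computability is required of a functional. *)
Definition functional : Type := (nat -> nat) -> nat.

Definition nat_itv (m k : nat) : set nat := [set n : nat | (m <= n <= k)%N].

Definition pointwise_metastable_bound (R : realType) (d : measure_display)
    (T : measurableType d) (mu : probability T R) (f : nat -> T -> R)
    (lambda eps : R) (M : functional) : Prop :=
  forall F : nat -> nat,
    (mu [set x | forall m : nat, (m <= M F)%N ->
           exists n n' : nat, [/\ nat_itv m (F m) n, nat_itv m (F m) n' &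
             (eps <= `|f n x - f n' x|)%R] ] < lambda%:E)%E.

Definition uniform_metastable_bound (R : realType) (d : measure_display)
    (T : measurableType d) (mu : probability T R) (f : nat -> T -> R)
    (lambda eps : R) (M : functional) : Prop :=
  forall F : nat -> nat, exists m : nat, (m <= M F)%N /\
    (mu [set x | exists n n' : nat,
           [/\ nat_itv m (F m) n, nat_itv m (F m) n' &
             (eps <= `|f n x - f n' x|)%R] ] < lambda%:E)%E.

(* Main.v *)
Require Import Defs.
From HB Require Import structures.
From mathcomp Require Import all_boot all_order all_algebra.
From mathcomp Require Import all_classical all_reals all_analysis.
From mathcomp Require Import ring lra.

Import Order.TTheory GRing.Theory Num.Theory.
Import numFieldNormedType.Exports.

Local Open Scope classical_set_scope.
Local Open Scope ring_scope.

(** Fix [F2] and write [A m k] for the event that the sequence oscillates by at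
    least [eps] somewhere on [[m, k]]; it decreases with [m] and increases with
    [k]. The value of the second functional at [F2] is obtained by compactness.
    If no bound worked, then for each [N] there would be a space satisfying the
    hypothesis on which [A m (F2 m)] has probability at least [lambda] for all
    [m <= N].

    Let [C i l] be the union of the [A i' (F2 i')] over [i <= i' <= l], and fix
    errors [delta i] whose sum is at most [lambda - lambda']. Along a free
    ultrafilter of indices [N], each increasing family of probabilities
    [mu (C i l)] admits an almost optimal [l i], which depends on neither [N]
    nor the space: for every [L], the inequality
    [mu (C i L) <= mu (C i (l i)) + delta i] holds for almost all [N]
    ([ultra_almost_max]). This one sequence [l] yields the function to which
    the hypothesis is applied: [F i] is the maximum of [F2] over [[0, l i]], so
    that [C i (l i)] is contained in
    [A i (F i)]. Only after [F] is fixed does [j = M1 F] become known; choose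
    then an index [N >= j] that is good for the finitely many [i <= j]
    ([simultaneous_almost_max]). For large [L] the set [C j L] has probability
    at least [lambda], lies in every [C i L] with [i <= j], and therefore
    exceeds the intersection of the [C i (l i)] by at most the sum of the
    [delta i] ([measure_le_bigcap_add]). So the intersection of the [A i (F i)],
    [i <= j], has probability at least [lambda'], against the hypothesis.

    The formulation by probabilities above [1 - lambda'] and [1 - lambda]
    follows by taking complements. *)

(** * Uniform approximation of bounded families along an ultrafilter *)

(** If every [l] could be improved by [delta] for almost all [N], about
    [1 / delta] successive improvements, still valid for almost all [N], would
    exceed the bound [1]. *)
Lemma ultra_almost_max (R : realType) (U : set_system nat) (c : nat -> nat -> R)
    (delta : R) :
  UltraFilter U -> 0 < delta -> (forall N l, 0 <= c N l <= 1) ->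
  exists l, forall L, U [set N | c N L <= c N l + delta].
Proof.
move=> UU delta_gt0 c01; apply: contrapT => /forallNP noL.
have /choice[g gP] : forall l, exists L, U [set N | c N l + delta < c N L].
  move=> l; have /existsNP[L nUL] := noL l; exists L.
  have [//|UC] := in_ultra_setVsetC [set N | c N L <= c N l + delta] UU.
  by apply: filterS UC => N /= /negP; rewrite -ltNge.
have climb k : U [set N | k%:R * delta <= c N (iter k g 0%N)].
  elim: k => [|k IHk].
    by apply: filterE => N /=; rewrite mul0r; case/andP: (c01 N 0%N).
  apply: filterS2 IHk (gP (iter k g 0%N)) => N /= ck /ltW; apply: le_trans.
  by rewrite -natr1 mulrDl mul1r lerD2r.
set k := (Num.truncn delta^-1).+1.
have k_large : 1 < k%:R * delta.
  by rewrite -ltr_pdivrMr// div1r truncnS_gt.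
have [N /= ckN] := filter_ex (climb k).
have := lt_le_trans k_large ckN.
by rewrite ltNge; case/andP: (c01 N (iter k g 0%N)) => _ ->.
Qed.

(** The choice of [l i] precedes that of [n], [L] and [N0]: the ultrafilter
    makes finitely many almost-maxima hold at a common, arbitrarily large index,
    although [l] was found one coordinate at a time. *)
Lemma simultaneous_almost_max (R : realType) (c : nat -> nat -> nat -> R)
    (delta : nat -> R) :
  (forall i, 0 < delta i) -> (forall N i l, 0 <= c N i l <= 1) ->
  exists l : nat -> nat, forall n L N0, exists2 N, (N0 <= N)%N &
    forall i, (i < n)%N -> c N i L <= c N i (l i) + delta i.
Proof.
move=> delta_gt0 c01.
have [U [UU ooU]] := ultraFilterLemma (F := \oo) _.
have /choice[l lP] : forall i, exists l, forall L,
    U [set N | c N i L <= c N i l + delta i].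
  by move=> i; apply: (@ultra_almost_max _ U (fun N => c N i)).
exists l => n L N0.
have common : U [set N | forall i, (i < n)%N ->
    c N i L <= c N i (l i) + delta i].
  elim: n => [|n IHn]; first by apply: filterE => N i.
  apply: filterS2 IHn (lP n L) => N cN cNn i; rewrite ltnS leq_eqVlt.
  by case/predU1P => [->//|]; apply: cN.
have large : U [set N | (N0 <= N)%N] by apply: ooU; exact: nbhs_infty_ge.
by have [N [? ?]] := filter_ex (filterI large common); exists N.
Qed.

(** * Events that nearly fill larger events *)

Section measure.
Context (R : realType) (d : measure_display) (T : measurableType d).
Variable mu : probability T R.

(** Intersecting with one more [E i] loses at most [mu (B i `\` E i)]. *)
Lemma measure_le_bigcap_add (X : set T) (B E : nat -> set T) (delta : nat -> R)
    (n : nat) :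
  measurable X -> (forall i, measurable (B i)) -> (forall i, measurable (E i)) ->
  (forall i, (i < n)%N -> [/\ X `<=` B i, E i `<=` B i &
     fine (mu (B i)) <= fine (mu (E i)) + delta i]) ->
  fine (mu X) <=
    fine (mu (X `&` \big[setI/setT]_(i < n) E i)) + \sum_(i < n) delta i.
Proof.
move=> mX mB mE; elim: n => [|n IHn] XEB.
  by rewrite !big_ord0 setIT addr0.
apply: (le_trans (IHn _)) => [i i_n|]; first by apply: XEB; exact: ltnW.
rewrite !big_ord_recr /= setIA; set Y := X `&` _.
have mY : measurable Y.
  by apply: measurableI => //; apply: bigsetI_measurable => i _.
have [XB EB muBE] := XEB n (ltnSn n).
have muDI (Z : set T) : measurable Z ->
    fine (mu Z) = fine (mu (Z `\` E n)) + fine (mu (Z `&` E n)).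
  move=> mZ; rewrite -fineD ?fin_num_measure//; last 2 first.
  - exact: measurableD.
  - exact: measurableI.
  by rewrite -measureDI.
have YB : fine (mu (Y `\` E n)) <= fine (mu (B n `\` E n)).
  apply: fine_le; rewrite ?fin_num_measure//; [exact: measurableD..|].
  apply: le_measure; rewrite ?inE//; [exact: measurableD..|].
  by apply: setSD => x [/XB].
have muY := muDI Y mY.
have muD := muDI _ (mB n); rewrite (setIidr EB) in muD.
lra.
Qed.

End measure.

Lemma sum_halves (R : realType) (x : R) (n : nat) :
  \sum_(i < n) x / 2 ^+ i.+1 = x - x / 2 ^+ n.
Proof.
elim: n => [|n IHn]; first by rewrite big_ord0 expr0 divr1 subrr.
rewrite big_ord_recr /= IHn exprS; field.
by rewrite expf_neq0.
Qed.

(** * The compactness argument *)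

(** Only the two monotonicity properties of the oscillation events matter here,
    so the argument is carried out for an arbitrary family [A] having them. The
    bound [N] precedes the space and the family. *)
Lemma uniform_bound_of_pointwise (R : realType) (lambda lambda' : R)
    (M1 : functional) (F2 : nat -> nat) :
  lambda' < lambda ->
  exists N : nat, forall (d : measure_display) (T : measurableType d)
      (mu : probability T R) (A : nat -> nat -> set T),
    (forall m k, measurable (A m k)) ->
    (forall m m' k k', (m <= m')%N -> (k' <= k)%N -> A m' k' `<=` A m k) ->
    (forall F : nat -> nat,
      (mu [set x | forall m, (m <= M1 F)%N -> A m (F m) x] < lambda'%:E)%E) ->
    exists m, (m <= N)%N /\ (mu (A m (F2 m)) < lambda%:E)%E.
Proof.
move=> lt_lambda; apply: contrapT => /forallNP noN.
pose C T (A : nat -> nat -> set T) i l :=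
  \bigcup_(i' in [set i' | (i <= i' <= l)%N]) A i' (F2 i').
(* Of each counterexample only the reals [c i l] are retained, so that the
   choice of one for each [N] does not involve the spaces themselves. *)
have /choice[c cP] : forall N, exists c : nat -> nat -> R,
    exists (d : measure_display) (T : measurableType d) (mu : probability T R)
      (A : nat -> nat -> set T),
    [/\ forall m k, measurable (A m k),
        forall m m' k k', (m <= m')%N -> (k' <= k)%N -> A m' k' `<=` A m k,
        forall F : nat -> nat,
          (mu [set x | forall m, (m <= M1 F)%N -> A m (F m) x] < lambda'%:E)%E,
        forall m, (m <= N)%N -> (lambda%:E <= mu (A m (F2 m)))%E &
        forall i l, c i l = fine (mu (C T A i l))].
  move=> N; apply: contrapT => noc.
  apply: (noN N) => d T mu A mA monoA smallA; apply: contrapT => nom.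
  apply: noc; exists (fun i l => fine (mu (C T A i l))), d, T, mu, A.
  split=> // m mN; rewrite leNgt; apply/negP => muA.
  by apply: nom; exists m.
have measurableC d (T : measurableType d) (A : nat -> nat -> set T) i l :
    (forall m k, measurable (A m k)) -> measurable (C T A i l).
  by move=> mA; apply: bigcup_measurable.
have c01 N i l : 0 <= c N i l <= 1.
  have [d [T [mu [A [mA _ _ _ ->]]]]] := cP N.
  rewrite fine_ge0//= -lee_fin fineK ?fin_num_measure ?probability_le1//;
    exact: measurableC.
pose delta i : R := (lambda - lambda') / 2 ^+ i.+1.
have delta_gt0 i : 0 < delta i by rewrite divr_gt0 ?subr_gt0 ?exprn_gt0.
have [l lP] := @simultaneous_almost_max R c delta delta_gt0 c01.
pose F m := (\max_(i < (l m).+1) F2 i)%N.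
pose j := M1 F.
pose L := maxn j (\max_(i < j.+1) l i).
have [N jN cN] := lP j.+1 L j.
have [d [T [mu [A [mA monoA smallA largeA cE]]]]] := cP N.
have lL i : (i < j.+1)%N -> (l i <= L)%N.
  move=> ij; rewrite leq_max; apply/orP; right.
  exact: (leq_bigmax (Ordinal ij)).
have nearly := @measure_le_bigcap_add R d T mu (C T A j L) (C T A ^~ L)
  (fun i => C T A i (l i)) delta j.+1.
have {nearly} : fine (mu (C T A j L)) <= fine (mu (C T A j L `&`
    \big[setI/setT]_(i < j.+1) C T A i (l i))) + \sum_(i < j.+1) delta i.
  apply: nearly => [|i|i|i ij]; try exact: measurableC.
  split; last by rewrite -!cE; exact: cN.
  - move=> x [i' /= /andP[ji' i'L] Ax]; exists i' => //=.
    by rewrite i'L andbT (leq_trans _ ji').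
  - move=> x [i' /= /andP[ii' i'l] Ax]; exists i' => //=.
    by rewrite ii' (leq_trans i'l) ?lL.
have largeC : lambda <= fine (mu (C T A j L)).
  rewrite -lee_fin fineK ?fin_num_measure//; last exact: measurableC.
  apply: (le_trans (largeA j jN)); apply: le_measure; rewrite ?inE//.
    exact: measurableC.
  by move=> x Ax; exists j => //=; rewrite leqnn leq_maxl.
set X := _ `&` _.
have smallX : fine (mu X) < lambda'.
  have mX : measurable X.
    apply: measurableI; first exact: measurableC.
    by apply: bigsetI_measurable => i _; exact: measurableC.
  rewrite -lte_fin fineK ?fin_num_measure//.
  apply: le_lt_trans (smallA F); apply: le_measure; rewrite ?inE//.
    rewrite (_ : mkset _ = \bigcap_(m in [set m | (m <= M1 F)%N]) A m (F m))//.
    by apply: bigcap_measurableType.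
  move=> x [_]; rewrite -(bigcap_mkord _ (fun i => C T A i (l i))) => Cx m mj.
  have [i' /= /andP[mi' i'l]] := Cx m mj.
  apply: monoA => //.
  exact: (leq_bigmax (Ordinal (i'l : (i' < (l m).+1)%N))).
rewrite sum_halves.
have : 0 < (lambda - lambda') / 2 ^+ j.+1 by exact: delta_gt0.
lra.
Qed.

(** * Oscillation events *)

Section oscillation.
Context (R : realType) (d : measure_display) (T : measurableType d).
Variables (f : nat -> T -> R) (eps : R).

Definition oscillation (m k : nat) : set T :=
  [set x | exists n n' : nat, [/\ nat_itv m k n, nat_itv m k n' &
     eps <= `|f n x - f n' x|]].

Lemma measurable_oscillation m k :
  (forall n, measurable_fun [set: T] (f n)) -> measurable (oscillation m k).
Proof.
move=> mf.
have -> : oscillation m k = \bigcup_(n in nat_itv m k)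
    \bigcup_(n' in nat_itv m k) [set x | eps <= `|f n x - f n' x|].
  apply/seteqP; split=> x.
    by move=> [n [n' [nmk n'mk ?]]]; exists n => //; exists n'.
  by move=> [n nmk [n' n'mk ?]]; exists n, n'.
apply: bigcup_measurable => n _; apply: bigcup_measurable => n' _.
rewrite -[X in measurable X]setTI.
have mdist : measurable_fun [set: T] (fun x => `|f n x - f n' x|).
  by apply: measurableT_comp => //; exact: measurable_realfun.measurable_funB.
have := mdist measurableT `[eps, +oo[%classic (measurable_itv _).
congr (measurable (_ `&` _)).
by apply/seteqP; split=> x /=; rewrite in_itv/= andbT.
Qed.

Lemma subset_oscillation m m' k k' : (m <= m')%N -> (k' <= k)%N ->
  oscillation m' k' `<=` oscillation m k.
Proof.
move=> mm' k'k x [n [n' [/andP[m'n nk'] /andP[m'n' n'k'] ?]]]; exists n, n'.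
by split=> //; apply/andP; split; [exact: leq_trans m'n|exact: leq_trans k'k|
  exact: leq_trans m'n'|exact: leq_trans k'k].
Qed.

Lemma setC_oscillation m k : ~` oscillation m k =
  [set x | forall n n', nat_itv m k n -> nat_itv m k n' ->
     `|f n x - f n' x| < eps].
Proof.
apply/seteqP; split=> x.
  move=> nosc n n' nmk n'mk; rewrite ltNge; apply/negP => ?.
  by apply: nosc; exists n, n'.
by move=> small [n [n' [nmk n'mk]]]; rewrite leNgt small.
Qed.

End oscillation.

Lemma probability_setC_gt (R : realType) (d : measure_display)
    (T : measurableType d) (mu : probability T R) (A : set T) (p : R) :
  measurable A -> ((1 - p)%:E < mu (~` A))%E = (mu A < p%:E)%E.
Proof.
move=> mA; rewrite probability_setC//.
rewrite -(@fineK _ (mu A)) ?fin_num_measure// -EFinB !lte_fin.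
by rewrite ltrD2l ltrN2.
Qed.

Theorem theorem3p1 (R : realType) (eps lambda lambda' : R) (M1 : functional)
    (eps_gt0 : 0 < eps) (lambda'_gt0 : 0 < lambda')
    (lambda'_lt : lambda' < lambda) :
  exists M2 : functional,
    forall (d : measure_display) (T : measurableType d)
           (mu : probability T R) (f : nat -> T -> R),
      (forall n : nat, measurable_fun [set: T] (f n)) ->
      (pointwise_metastable_bound mu f lambda' eps M1 ->
       uniform_metastable_bound mu f lambda eps M2)
      /\
      ((forall F1 : nat -> nat,
          ((1 - lambda')%:E <
           mu [set x | exists m : nat, (m <= M1 F1)%N /\
                 forall n n' : nat,
                   nat_itv m (F1 m) n -> nat_itv m (F1 m) n' ->
                   (`|f n x - f n' x| < eps)%R])%E) ->
       forall F2 : nat -> nat, exists m : nat, (m <= M2 F2)%N /\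
          ((1 - lambda)%:E <
           mu [set x | forall n n' : nat,
                 nat_itv m (F2 m) n -> nat_itv m (F2 m) n' ->
                 (`|f n x - f n' x| < eps)%R])%E).
Proof.
have /choice[M2 M2P] : forall F2 : nat -> nat, exists N, _ :=
  fun F2 => uniform_bound_of_pointwise R lambda lambda' M1 F2 lambda'_lt.
exists M2 => d T mu f mf.
have mosc m k := measurable_oscillation R d T f eps m k mf.
have pointwise_uniform : pointwise_metastable_bound mu f lambda' eps M1 ->
    uniform_metastable_bound mu f lambda eps M2.
  move=> small F2.
  exact: (M2P F2 d T mu (oscillation R d T f eps) mosc
    (subset_oscillation R d T f eps) small).
split=> // large F2.
have small : pointwise_metastable_bound mu f lambda' eps M1.
  move=> F; rewrite -probability_setC_gt; last first.
    by apply: (bigcap_measurableType (P := [set m | (m <= M1 F)%N])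
      (F := fun m => oscillation R d T f eps m (F m))) => //.
  rewrite (_ : ~` _ = [set x | exists m, (m <= M1 F)%N /\
    (~` oscillation R d T f eps m (F m)) x]); last first.
    apply/seteqP; split=> x; last by move=> [m [mM noscx]] /(_ m mM).
    by move=> /existsNP[m /not_implyP[mM noscx]]; exists m.
  by under eq_set do under eq_exists do rewrite setC_oscillation.
have [m [mM muosc]] := pointwise_uniform small F2.
by exists m; split=> //; rewrite -setC_oscillation probability_setC_gt.
Qed.
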